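(* Let $(U,g)$ be a metric structure. There exists a smooth $(1,2)$-extensor field $\omega_0$ on $U$ such that, for all $a,b,c\in\mathcal{V}(U)$, the Christoffel operator of first kind $[a,b,c]$ associated to $(U,g)$ can be written as $$[a,b,c]=\Big(a\cdot\partial_{o}b+\tfrac12\, g^{-1}\circ(a\cdot\partial_{o}g)(b)+\omega_{0}(a)\underset{g}{\times}b\Big)\underset{g}{\cdot}c .$$ Such $\omega_0$ is given by $$\omega_{0}(a)=-\tfrac14\,\underline{g}^{-1}(\partial_{b}\wedge\partial_{c})\;a\cdot\big((b\cdot\partial_{o}g)(c)-(c\cdot\partial_{o}g)(b)\big),$$ that is, for any basis $(e_i)$ of $\mathcal{U}_o$ with reciprocal basis $(e^i)$, $$\omega_0(a)=-\tfrac14\sum_{i,j} g^{-1}(e^i)\wedge g^{-1}(e^j)\;\, a\cdot\big((e_i\cdot\partial_o g)(e_j)-(e_j\cdot\partial_o g)(e_i)\big).$$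
   Context: Setting: $M$ is a smooth $n$-dimensional manifold, $U_o\subseteq M$ is the domain of a fixed chart with coordinates $x^1,\dots,x^n$, and $U\subseteq U_o$ is open. $\mathcal{U}_o$ is the (fixed) $n$-dimensional real vector space spanned by the coordinate basis $b_1,\dots,b_n$, with the Euclidean scalar product $\cdot$ for which $b_i\cdot b_j=\delta_{ij}$. $\bigwedge\mathcal{U}_o$ is its exterior algebra (multivectors), with the induced scalar product $(v_1\wedge\dots\wedge v_k)\cdot(w_1\wedge\dots\wedge w_k)=\det(v_i\cdot w_j)$, different grades being orthogonal. Two bases $(e_i)$, $(e^i)$ of $\mathcal{U}_o$ are reciprocal if $e_i\cdot e^j=\delta_i^j$. $\mathcal{S}(U)$, $\mathcal{V}(U)$, $\mathcal{M}(U)$ denote the smooth functions on $U$ with values in $\mathbb{R}$, $\mathcal{U}_o$, $\bigwedge\mathcal{U}_o$ respectively (smooth scalar, vector, multivector fields). For $a=a^ib_i\in\mathcal{V}(U)$, $a\cdot\partial_o=a^i\,\partial/\partial x^i$ acts on such fields componentwise with respect to the fixed (constant) basis; it depends on $a$ pointwise linearly. The bracket is $[a,b]=a\cdot\partial_o b-b\cdot\partial_o a$. A smooth $(p,q)$-extensor field on $U$ is a smooth assignment $x\mapsto t_{(x)}$ of a linear map $t_{(x)}:\bigwedge^p\mathcal{U}_o\to\bigwedge^q\mathcal{U}_o$ for $x\in U$; it acts on fields pointwise. So a $(1,2)$-extensor field maps vector fields to bivector fields. Its derivative is $(a\cdot\partial_o t)(X)=a\cdot\partial_o(t(X))-t(a\cdot\partial_oX)$,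 again an extensor field. $t^\dagger$ is the adjoint with respect to $\cdot$. The extended $\underline t$ of a $(1,1)$-extensor $t$ is the exterior algebra endomorphism with $\underline t(\alpha)=\alpha$ for scalars and $\underline t(v_1\wedge\dots\wedge v_k)=t(v_1)\wedge\dots\wedge t(v_k)$; $\underline{g}^{-1}$ is the extended of $g^{-1}$. A metric field on $U$ is a smooth $(1,1)$-extensor field $g$ on $U$ with $g_{(p)}=g_{(p)}^\dagger$ and $\det g_{(p)}\neq0$ for each $p\in U$; $(U,g)$ is called a metric structure. The $g$-scalar product is $X\underset{g}{\cdot}Y=\underline g(X)\cdot Y$. For a bivector $B$ and a vector $v$, $B\underset{g}{\times}v$ is the commutator $\frac12(Bv-vB)$ taken with respect to the Clifford product of $g$; explicitly $B\underset{g}{\times}v=-g(v)\lrcorner B$, where $u\lrcorner(x\wedge y)=(u\cdot x)y-(u\cdot y)x$ for vectors $u,x,y$. The Christoffel operator of first kind associated to $(U,g)$ is the map $\mathcal{V}(U)^3\to\mathcal{S}(U)$, $$[a,b,c]=\tfrac12\Big(a\cdot\partial_{o}(b\underset{g}{\cdot}c)+b\cdot\partial_{o}(c\underset{g}{\cdot}a)-c\cdot\partial_{o}(a\underset{g}{\cdot}b)+c\underset{g}{\cdot}[a,b]+b\underset{g}{\cdot}[c,a]-a\underset{g}{\cdot}[b,c]\Big).$$ In the formula for $\omega_0$, $\partial_b,\partial_c$ are vector derivative operators with respect to the vector variables $b,c$; applied to an expression $F(b,c)$ bilinear in $b,c\in\mathcal{U}_o$ they mean $(\partial_b\wedge\partial_c)F(b,c)=\sum_{i,j}e^i\wedge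 e^j\,F(e_i,e_j)$, and $\underline g^{-1}$ acts on $e^i\wedge e^j$. *)

(* Defs.v *)
(* MathComp and MathComp-Analysis, over an arbitrary realType. *)
From HB Require Import structures.
From mathcomp Require Import all_boot all_order all_algebra.
From mathcomp Require Import all_classical all_reals all_analysis.

Set Implicit Arguments.
Unset Strict Implicit.
Unset Printing Implicit Defensive.

Import Order.TTheory GRing.Theory Num.Theory numFieldNormedType.Exports.
Local Open Scope ring_scope.

(* Vectors of U_o are the row vectors 'rV[R]_n of their components in the
   coordinate basis, so that b_i is [delta_mx 0 i]. *)

(** * Smoothness on R^n *)

(* C^k on an open set W, through total differentiability: as [C^m W] for all m
   is what [smooth_on] asks for, this is the usual notion of C^infinity. *)
Fixpoint Ck_on (R : realType) (n k : nat) (W : set 'rV[R]_n)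
    (f : 'rV[R]_n -> R) : Prop :=
  match k with
  | 0%N => forall y, W y -> {for y, continuous f}
  | k'.+1 => (forall y, W y -> differentiable f y) /\
      forall i : 'I_n, Ck_on k' W (fun y => 'D_(delta_mx 0 i) f y)
  end.

Definition smooth_on (R : realType) (n : nat) (W : set 'rV[R]_n)
    (f : 'rV[R]_n -> R) : Prop :=
  forall k, Ck_on k W f.

(** * Smooth manifolds *)

(* [cmap] and [cinv] are meaningful only on [cdom] and [cmap @` cdom]. *)
Record chart (R : realType) (n : nat) (M : topologicalType) := Chart {
  cdom : set M;
  cmap : M -> 'rV[R]_n;
  cinv : 'rV[R]_n -> M;
  cdom_open : open cdom;
  cimg_open : open (cmap @` cdom)%classic;
  cmapK : forall x, cdom x -> cinv (cmap x) = x;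
  cmap_continuous : forall x, cdom x -> {for x, continuous cmap};
  cinv_continuous : forall y, (cmap @` cdom)%classic y ->
    {for y, continuous cinv}
}.

Record smoothManifold (R : realType) (n : nat) := SmoothManifold {
  carrier :> topologicalType;
  atlas : set (chart R n carrier);
  carrier_hausdorff : hausdorff_space carrier;
  carrier_second_countable : @second_countable carrier;
  atlas_cover : forall x, exists2 c, atlas c & cdom c x;
  atlas_smooth : forall c d, atlas c -> atlas d -> forall j : 'I_n,
    smooth_on (cmap c @` (cdom c `&` cdom d))%classic
      (fun y => cmap d (cinv c y) 0 j)
}.

(** * Exterior algebra of U_o *)

(* A multivector is the family of its components in the basis of blades
   b_A = b_i1 /\ ... /\ b_ik, where A = {i1 < ... < ik}. *)
Notation multivector R n := {ffun {set 'I_n} -> R^o}.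

Definition coef (R : realType) (n : nat) (X : multivector R n)
    (A : {set 'I_n}) : R := X A.

Definition blade (R : realType) (n : nat) (A : {set 'I_n}) : multivector R n :=
  [ffun B => (B == A)%:R].

Definition of_vec (R : realType) (n : nat) (v : 'rV[R]_n) : multivector R n :=
  \sum_(i < n) v 0 i *: blade R [set i].

Definition of_grade (R : realType) (n p : nat) (X : multivector R n) : Prop :=
  forall A : {set 'I_n}, #|A| != p -> coef X A = 0.

(* b_A /\ b_B = (-1) ^ (inversions A B) b_(A :|: B) for disjoint A and B. *)
Definition inversions (n : nat) (A B : {set 'I_n}) : nat :=
  #|[set p : 'I_n * 'I_n | [&& p.1 \in A, p.2 \in B & (p.2 < p.1)%N]]|.

Definition wedge (R : realType) (n : nat) (X Y : multivector R n) :
    multivector R n :=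
  \sum_(A : {set 'I_n}) \sum_(B : {set 'I_n} | [disjoint A & B])
    ((-1) ^+ inversions A B * coef X A * coef Y B) *: blade R (A :|: B).

Definition vdot (R : realType) (n : nat) (v w : 'rV[R]_n) : R :=
  \sum_(i < n) v 0 i * w 0 i.

(* det (b_i . b_j) makes the blades orthonormal. *)
Definition mvdot (R : realType) (n : nat) (X Y : multivector R n) : R :=
  \sum_(A : {set 'I_n}) coef X A * coef Y A.

(* u _| (v_1 /\ ... /\ v_k) =
   \sum_r (-1)^(r-1) (u . v_r) v_1 /\ ... (v_r omitted) ... /\ v_k *)
Definition lcontr (R : realType) (n : nat) (u : 'rV[R]_n)
    (X : multivector R n) : multivector R n :=
  \sum_(A : {set 'I_n}) \sum_(i in A)
    ((-1) ^+ #|[set j in A | (j < i)%N]| * u 0 i * coef X A)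
      *: blade R (A :\ i).

(* The index set A is enumerated increasingly, as in b_A. *)
Definition extended_end (R : realType) (n : nat) (t : 'End('rV[R]_n))
    (X : multivector R n) : multivector R n :=
  \sum_(A : {set 'I_n})
    coef X A *: \big[@wedge R n/blade R finset.set0]_(i in A)
                  of_vec (t (delta_mx 0 i)).

Definition adjoint_end (R : realType) (n : nat) (t : 'End('rV[R]_n)) :
    'End('rV[R]_n) :=
  linfun (fun v : 'rV[R]_n => \row_i vdot v (t (delta_mx 0 i))).

Definition reciprocal_bases (R : realType) (n : nat)
    (e e' : n.-tuple 'rV[R]_n) : Prop :=
  [/\ basis_of fullv e, basis_of fullv e' &
      forall i j : 'I_n, vdot (tnth e i) (tnth e' j) = (i == j)%:R].

(* g-scalar product, and commutator of a bivector with a vector in the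
   Clifford algebra of g. *)
Definition gdot (R : realType) (n : nat) (g : 'End('rV[R]_n))
    (X Y : multivector R n) : R :=
  mvdot (extended_end g X) Y.

Definition gcomm (R : realType) (n : nat) (g : 'End('rV[R]_n))
    (B : multivector R n) (v : 'rV[R]_n) : multivector R n :=
  - lcontr (g v) B.

(** * Smooth fields on an open subset U of a manifold *)

(* Fields are total functions; their values outside U are irrelevant. *)
Definition smooth_scalar (R : realType) (n : nat) (M : smoothManifold R n)
    (U : set M) (f : M -> R) : Prop :=
  forall c : chart R n M, atlas c ->
    smooth_on (cmap c @` (U `&` cdom c))%classic (f \o cinv c).

Definition smooth_vector (R : realType) (n : nat) (M : smoothManifold R n)
    (U : set M) (a : M -> 'rV[R]_n) : Prop :=
  forall j : 'I_n, smooth_scalar U (fun x => a x 0 j).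

Definition smooth_multivector (R : realType) (n : nat)
    (M : smoothManifold R n) (U : set M) (X : M -> multivector R n) : Prop :=
  forall A : {set 'I_n}, smooth_scalar U (fun x => coef (X x) A).

Definition extensor_field11 (R : realType) (n : nat) (M : smoothManifold R n)
    (U : set M) (t : M -> 'End('rV[R]_n)) : Prop :=
  forall i : 'I_n, smooth_vector U (fun x => t x (delta_mx 0 i)).

Definition extensor_field12 (R : realType) (n : nat) (M : smoothManifold R n)
    (U : set M) (t : M -> 'Hom('rV[R]_n, multivector R n)) : Prop :=
  (forall x, U x -> forall v, of_grade 2 (t x v)) /\
  forall i : 'I_n, smooth_multivector U (fun x => t x (delta_mx 0 i)).

Definition metric_field (R : realType) (n : nat) (M : smoothManifold R n)
    (U : set M) (g : M -> 'End('rV[R]_n)) : Prop :=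
  extensor_field11 U g /\
  forall x, U x -> adjoint_end (g x) = g x /\ \det (lin1_mx (g x)) != 0.

(** * The derivative a . d_o in the chart phi

   a . d_o F at x depends on a only through the vector v = a x, which is what
   the following definitions take as argument. *)

Definition dscalar (R : realType) (n : nat) (M : topologicalType)
    (phi : chart R n M) (v : 'rV[R]_n) (f : M -> R) (x : M) : R :=
  \sum_(i < n) v 0 i * 'D_(delta_mx 0 i) (f \o cinv phi) (cmap phi x).

Definition dvector (R : realType) (n : nat) (M : topologicalType)
    (phi : chart R n M) (v : 'rV[R]_n) (b : M -> 'rV[R]_n) (x : M) :
    'rV[R]_n :=
  \row_j dscalar phi v (fun y => b y 0 j) x.

Definition dextensor (R : realType) (n : nat) (M : topologicalType)
    (phi : chart R n M) (v : 'rV[R]_n) (t : M -> 'End('rV[R]_n))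
    (b : M -> 'rV[R]_n) (x : M) : 'rV[R]_n :=
  dvector phi v (fun y => t y (b y)) x - t x (dvector phi v b x).

Definition bracket (R : realType) (n : nat) (M : topologicalType)
    (phi : chart R n M) (a b : M -> 'rV[R]_n) (x : M) : 'rV[R]_n :=
  dvector phi (a x) b x - dvector phi (b x) a x.

Definition gdot_vec (R : realType) (n : nat) (M : Type)
    (g : M -> 'End('rV[R]_n)) (a b : M -> 'rV[R]_n) (x : M) : R :=
  gdot (g x) (of_vec (a x)) (of_vec (b x)).

Definition christoffel1 (R : realType) (n : nat) (M : topologicalType)
    (phi : chart R n M) (g : M -> 'End('rV[R]_n))
    (a b c : M -> 'rV[R]_n) (x : M) : R :=
  2^-1 * (dscalar phi (a x) (gdot_vec g b c) x
        + dscalar phi (b x) (gdot_vec g c a) x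
        - dscalar phi (c x) (gdot_vec g a b) x
        + gdot_vec g c (bracket phi a b) x
        + gdot_vec g b (bracket phi c a) x
        - gdot_vec g a (bracket phi b c) x).

(** * The property defining omega_0, and its explicit value *)

Definition christoffel_representation (R : realType) (n : nat)
    (M : smoothManifold R n) (phi : chart R n M) (U : set M)
    (g : M -> 'End('rV[R]_n))
    (w : M -> 'Hom('rV[R]_n, multivector R n)) : Prop :=
  forall a b c : M -> 'rV[R]_n,
  smooth_vector U a -> smooth_vector U b -> smooth_vector U c ->
  forall x, U x ->
    christoffel1 phi g a b c x =
    gdot (g x)
      (of_vec (dvector phi (a x) b x
               + 2^-1 *: (g x)^-1%VF (dextensor phi (a x) g b x))
       + gcomm (g x) (w x (a x)) (b x))
      (of_vec (c x)).

(* v . ((b . d_o g)(c) - (c . d_o g)(b)) for constant vectors b and c *)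
Definition dg_skew (R : realType) (n : nat) (M : topologicalType)
    (phi : chart R n M) (g : M -> 'End('rV[R]_n)) (x : M)
    (v b c : 'rV[R]_n) : R :=
  vdot v (dextensor phi b g (fun=> c) x - dextensor phi c g (fun=> b) x).

(* Main.v *)
Require Import Defs.
From HB Require Import structures.
From mathcomp Require Import all_boot all_order all_algebra.
From mathcomp Require Import all_classical all_reals all_analysis.
From mathcomp Require Import ring lra.

Set Implicit Arguments.
Unset Strict Implicit.
Unset Printing Implicit Defensive.

Import Order.TTheory GRing.Theory Num.Theory numFieldNormedType.Exports.
Local Open Scope ring_scope.

(** Write [d_a] for the derivative along a.  By the product rule, in
    [a,b,c] the derivatives of the vector fields cancel against the brackets,
    except for [d_a b], and there remains

      g(d_a b) . c + (1/2) ((d_a g) b) . c + (1/2) S(b, c),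
      S(b, c) = a . ((d_b g) c - (d_c g) b),

    because [d_v g] is tensorial and, like g, self-adjoint
    ([christoffel1E]).  The first two terms are the ones of the claimed
    formula that do not involve omega_0.  For the third one, contraction is
    adjoint to exterior multiplication ([mvdot_lcontr]), so that

      g(W x b) . c = - (g(b) _| W) . g(c) = - W . (g(b) /\ g(c))

    for a bivector W ([gdot_gcomm]).  The representation therefore says
    exactly that W = omega_0(a) satisfies W . (g(b) /\ g(c)) = - S(b, c) / 2
    for all vectors b and c ([representation_at]).

    The explicit formula does: (u /\ v) . (r /\ s) is the Gram determinant
    ([mvdot_wedge]), and g^-1(e^i) . g(b) = e^i . b is the i-th coordinate of
    b in the basis e, so that the sum over i and j rebuilds
    S(b, c) - S(c, b) = 2 S(b, c) ([mvdot_skew_bivector]).  It is moreover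
    the only solution, since the bivectors g(b) /\ g(c) span all bivectors
    when g is invertible ([bivector_eq]); in particular it does not depend on
    the reciprocal bases.

    Smoothness of omega_0 has to be seen in every chart of the atlas, while
    the derivatives are taken in the chart phi.  It rests on closure of C^k
    under sums, products and composition ([smooth_on_comp]), applied to the
    transition maps ([smooth_scalar_derive]), and on the cofactor formula for
    g^-1 ([smooth_scalar_invmx]). *)

(** * Smooth functions on open sets of R^n *)

(** The differential of f at x is a differential of g as well, and it is the one
    chosen for g because differentials are unique. *)
Lemma near_eq_differentiable (R : realType) (V W : normedModType R)
    (f g : V -> W) (x : V) :
  {near x, f =1 g} -> differentiable f x -> differentiable g x.
Proof.
move=> fg df.
have gE : g \o shift x = cst (g x) + 'd f x +o_ 0 id.
  have /eqaddoP fo := diff_locally df; apply/eqaddoP => e e0.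
  have := fo e e0; apply: filterS2; last first.
    have : \forall h \near (0 : V), f (h + x) = g (h + x).
      by rewrite (near_shift x)/= ; near=> y; rewrite /= sub0r subrK; near: y.
    by exact.
  move=> h /= fgh.
  rewrite -![(_ - _) h]/(_ h - _ h) -![(_ + _) h]/(_ h + _ h) /cst /=.
  by rewrite fgh (nbhs_singleton fg).
have dE := diff_unique (diff_continuous df) gE.
by apply/diff_locallyP; rewrite dE; split => //; exact: diff_continuous df.
Unshelve. all: by end_near. Qed.

Section CkCalculus.
Context (R : realType) (n : nat).
Implicit Types (W : set 'rV[R]_n) (f g : 'rV[R]_n -> R).

Lemma eq_Ck_on k W f g :
  open W -> (forall y, W y -> f y = g y) -> Ck_on k W f -> Ck_on k W g.
Proof.
move=> oW; elim: k f g => [|k IH] f g fg /=.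
  move=> cf y Wy; have nfg : {near y, f =1 g}.
    by apply: filterS (open_nbhs_nbhs (conj oW Wy)) => z; exact: fg.
  have cg : (g @ y --> g y)%classic.
    rewrite -(fg y Wy); exact: cvg_trans (near_eq_cvg nfg) (cf y Wy).
  exact: cg.
have nfg y : W y -> {near y, f =1 g}.
  by move=> Wy; apply: filterS (open_nbhs_nbhs (conj oW Wy)) => z; exact: fg.
move=> [df Df]; split=> [y Wy|i];
  first exact: near_eq_differentiable (nfg y Wy) (df y Wy).
by apply: IH (Df i) => y Wy; exact: near_eq_derive (nfg y Wy).
Qed.

Lemma Ck_on_pred k W f : Ck_on k.+1 W f -> Ck_on k W f.
Proof.
elim: k f => [|k IH] f [df Df].
  by move=> y Wy; exact: differentiable_continuous (df y Wy).
by split => // i; exact: IH (Df i).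
Qed.

Lemma Ck_on_sub k W W' f : (W' `<=` W)%classic -> Ck_on k W f -> Ck_on k W' f.
Proof.
move=> sW; elim: k f => [|k IH] f /=; first by move=> cf y /sW; exact: cf.
by move=> [df Df]; split => [y /sW|i]; [exact: df|exact: IH].
Qed.

Lemma Ck_on_cst k W (r : R) : Ck_on k W (fun=> r).
Proof.
elim: k r => [|k IH] r; first by move=> y _; exact: cst_continuous.
split=> [y _|i]; first exact: differentiable_cst.
have -> : (fun y : 'rV[R]_n => 'D_(delta_mx 0 i) (fun=> r) y) = fun=> 0.
  by apply/funext => y; exact: derive_cst.
exact: IH.
Qed.

Lemma Ck_onD k W f g : open W ->
  Ck_on k W f -> Ck_on k W g -> Ck_on k W (fun y => f y + g y).
Proof.
move=> oW; elim: k f g => [|k IH] f g /=.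
  by move=> cf cg y Wy; exact: continuousD (cf y Wy) (cg y Wy).
move=> [df Df] [dg Dg]; split=> [y Wy|i].
  exact: (differentiableD (df y Wy) (dg y Wy)).
apply: eq_Ck_on (IH _ _ (Df i) (Dg i)) => // y Wy.
by rewrite -deriveD//; apply: diff_derivable; [exact: df|exact: dg].
Qed.

Lemma Ck_onM k W f g : open W ->
  Ck_on k W f -> Ck_on k W g -> Ck_on k W (fun y => f y * g y).
Proof.
move=> oW; elim: k f g => [|k IH] f g.
  by move=> cf cg y Wy; exact: continuousM (cf y Wy) (cg y Wy).
move=> Cf Cg; have [df Df] := Cf; have [dg Dg] := Cg.
split=> [y Wy|i]; first exact: (differentiableM (df y Wy) (dg y Wy)).
apply: eq_Ck_on (Ck_onD oW (IH _ _ (Ck_on_pred Cf) (Dg i))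
  (IH _ _ (Ck_on_pred Cg) (Df i))) => // y Wy.
rewrite -[RHS]/('D_(delta_mx 0 i) (f * g) y) deriveM//.
  by apply: diff_derivable; exact: df.
by apply: diff_derivable; exact: dg.
Qed.

Lemma Ck_on_sum k W (I : Type) (r : seq I) (P : pred I)
    (f : I -> 'rV[R]_n -> R) :
  open W -> (forall i, P i -> Ck_on k W (f i)) ->
  Ck_on k W (fun y => \sum_(i <- r | P i) f i y).
Proof.
move=> oW Cf; elim: r => [|i r IH].
  by apply: eq_Ck_on (Ck_on_cst k W 0) => // y _; rewrite big_nil.
case Pi : (P i); last first.
  by apply: eq_Ck_on IH => // y _; rewrite big_cons Pi.
by apply: eq_Ck_on (Ck_onD oW (Cf i Pi) IH) => // y _; rewrite big_cons Pi.
Qed.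

Lemma smooth_on_cst W (r : R) : smooth_on W (fun=> r).
Proof. by move=> k; exact: Ck_on_cst. Qed.

Lemma smooth_onD W f g : open W ->
  smooth_on W f -> smooth_on W g -> smooth_on W (fun y => f y + g y).
Proof. by move=> oW sf sg k; exact: Ck_onD. Qed.

Lemma smooth_onM W f g : open W ->
  smooth_on W f -> smooth_on W g -> smooth_on W (fun y => f y * g y).
Proof. by move=> oW sf sg k; exact: Ck_onM. Qed.

Lemma smooth_on_diff W f y : smooth_on W f -> W y -> differentiable f y.
Proof. by move=> /(_ 1%N) [df _]; exact: df. Qed.

Lemma smooth_on_derive W f i :
  smooth_on W f -> smooth_on W (fun y => 'D_(delta_mx 0 i) f y).
Proof. by move=> sf k; have [_] := sf k.+1; exact. Qed.

(** The derivative of 1 / f is again built from 1 / f and the derivatives of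
    f by products, so that the order of differentiability can be raised. *)
Lemma smooth_onV W f : open W -> (forall y, W y -> f y != 0) ->
  smooth_on W f -> smooth_on W (fun y => (f y)^-1).
Proof.
move=> oW f0 sf; elim=> [|k IH].
  by move=> y Wy; exact: continuousV (f0 y Wy) (sf 0%N y Wy).
split=> [y Wy|i].
  by apply: differentiableV; [exact: smooth_on_diff Wy|exact: f0].
pose h y := (f y)^-1 * (f y)^-1.
apply: eq_Ck_on (Ck_onM oW (Ck_on_cst k W (-1)) (Ck_onM oW (Ck_onM oW IH IH)
  (smooth_on_derive i sf k))) => // y Wy.
rewrite deriveV; [|exact: f0|exact/diff_derivable/(smooth_on_diff sf)].
by rewrite mulN1r /GRing.scale /= mulNr -invfM expr2.
Qed.

End CkCalculus.

Lemma differentiable_rV (R : realType) (m n : nat)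
    (h : 'rV[R]_m -> 'rV[R]_n) (y : 'rV[R]_m) :
  (forall j, differentiable (fun z => h z 0 j) y) -> differentiable h y.
Proof.
move=> dh.
have -> : h = \sum_(j < n) (fun z => h z 0 j *: delta_mx 0 j).
  by apply/funext => z; rewrite fct_sumE [LHS]row_sum_delta.
by apply: differentiable_sum => j; apply: differentiableZl; exact: dh.
Qed.

Lemma chain_rule (R : realType) (m n : nat)
    (h : 'rV[R]_m -> 'rV[R]_n) (f : 'rV[R]_n -> R) (y v : 'rV[R]_m) :
  (forall j, differentiable (fun z => h z 0 j) y) ->
  differentiable f (h y) ->
  'D_v (f \o h) y =
    \sum_(j < n) 'D_(delta_mx 0 j) f (h y) * 'D_v (fun z => h z 0 j) y.
Proof.
move=> dhj df; have dh := differentiable_rV dhj.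
rewrite deriveE; last exact: differentiable_comp.
rewrite diff_comp//= -(deriveE _ dh) derive_mx; last exact: diff_derivable.
rewrite [X in 'd f (h y) X]row_sum_delta linear_sum; apply: eq_bigr => j _.
rewrite linearZ /= mxE (deriveE _ df) mulrC; exact: erefl.
Qed.

(** By the chain rule, a partial derivative of f \o h is a sum of products of
    some D_j f composed with h, to which the induction on the order applies,
    and of derivatives of the components of h. *)
Lemma smooth_on_comp (R : realType) (m n : nat) (W : set 'rV[R]_m)
    (V : set 'rV[R]_n) (h : 'rV[R]_m -> 'rV[R]_n) (f : 'rV[R]_n -> R) :
  open W -> (forall y, W y -> V (h y)) ->
  (forall j, smooth_on W (fun y => h y 0 j)) ->
  smooth_on V f -> smooth_on W (f \o h).
Proof.
move=> oW hV sh sf k; elim: k f sf => [|k IH] f sf.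
  move=> y Wy; apply: differentiable_continuous; apply: differentiable_comp.
    by apply: differentiable_rV => j; exact: smooth_on_diff (sh j) Wy.
  exact: smooth_on_diff sf (hV y Wy).
have dh y : W y -> forall j, differentiable (fun z => h z 0 j) y.
  by move=> Wy j; exact: smooth_on_diff (sh j) Wy.
have df y (Wy : W y) := smooth_on_diff sf (hV y Wy).
split=> [y Wy|i].
  by apply: differentiable_comp; [apply: differentiable_rV; exact: dh|exact: df].
apply: (@eq_Ck_on _ _ _ _ (fun y => \sum_(j < n)
  ('D_(delta_mx 0 j) f \o h) y * 'D_(delta_mx 0 i) (fun z => h z 0 j) y)) => //.
  by move=> y Wy; rewrite chain_rule//; [exact: dh|exact: df].
apply: Ck_on_sum => // j _; apply: Ck_onM => //; last exact: smooth_on_derive.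
by apply: IH; exact: smooth_on_derive.
Qed.

(** * Smooth fields on an open subset of a manifold *)

Section SmoothFields.
Context (R : realType) (n : nat) (M : smoothManifold R n).
Implicit Types (U : set M) (c : chart R n M) (f g : M -> R).

Lemma chart_image_open U c : open U -> open (cmap c @` (U `&` cdom c))%classic.
Proof.
move=> oU; rewrite openE => _ [x [Ux cx] <-].
have imx : (cmap c @` cdom c)%classic (cmap c x) by exists x.
have Ui : \forall y \near cmap c x, U (cinv c y).
  apply: (cinv_continuous imx); rewrite cmapK//.
  exact: open_nbhs_nbhs.
have ci : nbhs (cmap c x) (cmap c @` cdom c)%classic.
  by apply: open_nbhs_nbhs; split => //; exact: cimg_open.
apply: filterS2 Ui ci => y Uy [z cz zy]; exists z => //; split => //.
by rewrite -(cmapK cz) zy.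
Qed.

Lemma eq_smooth_scalar U f g : open U -> (forall x, U x -> f x = g x) ->
  smooth_scalar U f -> smooth_scalar U g.
Proof.
move=> oU fg sf c ac k; apply: eq_Ck_on (sf c ac k).
  exact: chart_image_open.
by move=> _ [x [Ux cx] <-] /=; rewrite cmapK// fg.
Qed.

Lemma smooth_scalar_cst U (r : R) : smooth_scalar U (fun=> r).
Proof. by move=> c _; exact: smooth_on_cst. Qed.

Lemma smooth_scalarD U f g : open U -> smooth_scalar U f -> smooth_scalar U g ->
  smooth_scalar U (fun x => f x + g x).
Proof.
by move=> oU sf sg c ac; apply: smooth_onD (sf c ac) (sg c ac);
  exact: chart_image_open.
Qed.

Lemma smooth_scalarM U f g : open U -> smooth_scalar U f -> smooth_scalar U g ->
  smooth_scalar U (fun x => f x * g x).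
Proof.
by move=> oU sf sg c ac; apply: smooth_onM (sf c ac) (sg c ac);
  exact: chart_image_open.
Qed.

Lemma smooth_scalarV U f : open U -> (forall x, U x -> f x != 0) ->
  smooth_scalar U f -> smooth_scalar U (fun x => (f x)^-1).
Proof.
move=> oU f0 sf c ac; apply: smooth_onV (sf c ac);
  first exact: chart_image_open.
by move=> _ [x [Ux cx] <-] /=; rewrite cmapK//; exact: f0.
Qed.

Lemma smooth_scalar_sum U (I : Type) (r : seq I) (P : pred I)
    (f : I -> M -> R) :
  open U -> (forall i, smooth_scalar U (f i)) ->
  smooth_scalar U (fun x => \sum_(i <- r | P i) f i x).
Proof.
move=> oU sf c ac k; apply: Ck_on_sum; first exact: chart_image_open.
by move=> i _; exact: (sf i c ac k).
Qed.

Lemma smooth_scalar_prod U (I : Type) (r : seq I) (P : pred I)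
    (f : I -> M -> R) :
  open U -> (forall i, smooth_scalar U (f i)) ->
  smooth_scalar U (fun x => \prod_(i <- r | P i) f i x).
Proof.
move=> oU sf; elim: r => [|i r IH].
  by apply: eq_smooth_scalar (smooth_scalar_cst U 1) => // x _; rewrite big_nil.
case Pi : (P i); last first.
  by apply: eq_smooth_scalar IH => // x _; rewrite big_cons Pi.
apply: eq_smooth_scalar (smooth_scalarM oU (sf i) IH) => // x _.
by rewrite big_cons Pi.
Qed.

Lemma smooth_scalar_det U m (A : M -> 'M[R]_m) : open U ->
  (forall i j, smooth_scalar U (fun x => A x i j)) ->
  smooth_scalar U (fun x => \det (A x)).
Proof.
move=> oU sA; apply: smooth_scalar_sum => // s.
apply: smooth_scalarM => //; first exact: smooth_scalar_cst.
exact: smooth_scalar_prod.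
Qed.

Lemma smooth_scalar_invmx U m (A : M -> 'M[R]_m) : open U ->
  (forall i j, smooth_scalar U (fun x => A x i j)) ->
  (forall x, U x -> \det (A x) != 0) ->
  forall i j, smooth_scalar U (fun x => invmx (A x) i j).
Proof.
move=> oU sA dA i j.
apply: (@eq_smooth_scalar _ (fun x => (\det (A x))^-1 *
    ((-1) ^+ (j + i) * \det (row' j (col' i (A x)))))) => //.
  by move=> x Ux; rewrite /invmx unitmxE unitfE dA// !mxE.
apply: smooth_scalarM => //.
  by apply: smooth_scalarV => //; exact: smooth_scalar_det.
apply: smooth_scalarM => //; first exact: smooth_scalar_cst.
apply: smooth_scalar_det => // p q.
by apply: eq_smooth_scalar (sA (lift j p) (lift i q)) => // x _; rewrite !mxE.
Qed.

Section InChart.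
Context (phi : chart R n M) (U : set M).
Hypotheses (aphi : atlas phi) (oU : open U) (Uphi : (U `<=` cdom phi)%classic).

(** Read in a second chart of the atlas, the partial derivative is composed
    with the transition map to phi, which is smooth. *)
Lemma smooth_scalar_derive f i : smooth_scalar U f ->
  smooth_scalar U (fun x => 'D_(delta_mx 0 i) (f \o cinv phi) (cmap phi x)).
Proof.
move=> sf c ac; have oW := @chart_image_open U c oU.
have sD := smooth_on_derive i (sf phi aphi).
apply: (@smooth_on_comp _ _ _ _ _ (cmap phi \o cinv c) _ oW _ _ sD).
  move=> _ [x [Ux cx] <-] /=; rewrite cmapK//; exists x => //.
  by split => //; exact: Uphi.
move=> j k; apply: Ck_on_sub (atlas_smooth ac aphi j k).
by move=> _ [x [Ux cx] <-]; exists x => //; split => //; exact: Uphi.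
Qed.

Lemma smooth_scalar_diff f x : smooth_scalar U f -> U x ->
  differentiable (f \o cinv phi) (cmap phi x).
Proof.
move=> sf Ux; apply: (smooth_on_diff (sf phi aphi)).
by exists x => //; split => //; exact: Uphi.
Qed.

Lemma eq_dscalar f g v x : (forall y, U y -> f y = g y) -> U x ->
  dscalar phi v f x = dscalar phi v g x.
Proof.
move=> fg Ux; apply: eq_bigr => i _; congr (_ * _); apply: near_eq_derive.
have : (cmap phi @` (U `&` cdom phi))%classic (cmap phi x).
  by exists x => //; split => //; exact: Uphi.
move=> xW; apply: filterS (open_nbhs_nbhs (conj (@chart_image_open U phi oU) xW)).
by move=> _ [y [Uy cy] <-] /=; rewrite cmapK// fg.
Qed.

Lemma dscalar_cst r v x : dscalar phi v (fun=> r) x = 0.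
Proof.
by apply: big1 => i _; rewrite [X in _ * X]derive_cst mulr0.
Qed.

Lemma dscalarD f g v x : smooth_scalar U f -> smooth_scalar U g -> U x ->
  dscalar phi v (fun y => f y + g y) x = dscalar phi v f x + dscalar phi v g x.
Proof.
move=> sf sg Ux; rewrite -big_split; apply: eq_bigr => i _ /=.
rewrite -mulrDr -deriveD//; exact/diff_derivable/smooth_scalar_diff.
Qed.

Lemma dscalarM f g v x : smooth_scalar U f -> smooth_scalar U g -> U x ->
  dscalar phi v (fun y => f y * g y) x =
  dscalar phi v f x * g x + f x * dscalar phi v g x.
Proof.
move=> sf sg Ux; rewrite mulr_suml mulr_sumr -big_split;
  apply: eq_bigr => i _ /=.
rewrite [X in _ * X](@deriveM _ _ (f \o cinv phi) (g \o cinv phi));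
  [|exact/diff_derivable/smooth_scalar_diff..].
rewrite /GRing.scale /= cmapK; [ring|exact: Uphi].
Qed.

Lemma dscalar_sum (I : Type) (r : seq I) (F : I -> M -> R) v x :
  (forall i, smooth_scalar U (F i)) -> U x ->
  dscalar phi v (fun y => \sum_(i <- r) F i y) x =
  \sum_(i <- r) dscalar phi v (F i) x.
Proof.
move=> sF Ux; elim: r => [|i r IH].
  rewrite big_nil -[RHS](dscalar_cst 0 v x).
  by apply: eq_dscalar => // y _; rewrite big_nil.
rewrite big_cons -IH -dscalarD//; last exact: smooth_scalar_sum.
by apply: eq_dscalar => // y _; rewrite big_cons.
Qed.

Lemma dscalar_vdot (a b : M -> 'rV[R]_n) v x :
  smooth_vector U a -> smooth_vector U b -> U x ->
  dscalar phi v (fun y => vdot (a y) (b y)) x =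
  vdot (dvector phi v a x) (b x) + vdot (a x) (dvector phi v b x).
Proof.
move=> sa sb Ux; rewrite dscalar_sum//; last first.
  by move=> i; apply: smooth_scalarM.
rewrite -big_split; apply: eq_bigr => i _ /=.
by rewrite dscalarM// !mxE.
Qed.

End InChart.
End SmoothFields.

(** * Vectors and bivectors in the exterior algebra *)

Lemma linear_sumZ (K : nzRingType) (V W : lmodType K) (f : V -> W) :
  linear f -> forall (I : Type) (r : seq I) (a : I -> K) (x : I -> V),
  f (\sum_(i <- r) a i *: x i) = \sum_(i <- r) a i *: f (x i).
Proof.
move=> lf I r a x.
have f0 : f 0 = 0 by have := lf (-1) 0 0; rewrite scaler0 addr0 scaleN1r addNr.
elim: r => [|i r IH]; first by rewrite !big_nil.
by rewrite !big_cons lf IH.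
Qed.

Section Vdot.
Context (R : realType) (n : nat).
Implicit Types u v w : 'rV[R]_n.

Lemma vdotC u v : vdot u v = vdot v u.
Proof. by apply: eq_bigr => i _; rewrite mulrC. Qed.

Lemma vdotDl u v w : vdot (u + v) w = vdot u w + vdot v w.
Proof. by rewrite -big_split; apply: eq_bigr => i _; rewrite mxE mulrDl. Qed.

Lemma vdotZl k u v : vdot (k *: u) v = k * vdot u v.
Proof. by rewrite mulr_sumr; apply: eq_bigr => i _; rewrite mxE mulrA. Qed.

Lemma vdotBl u v w : vdot (u - v) w = vdot u w - vdot v w.
Proof. by rewrite -scaleN1r vdotDl vdotZl mulN1r. Qed.

Lemma vdotDr u v w : vdot u (v + w) = vdot u v + vdot u w.
Proof. by rewrite vdotC vdotDl !(vdotC _ u). Qed.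

Lemma vdotBr u v w : vdot u (v - w) = vdot u v - vdot u w.
Proof. by rewrite vdotC vdotBl !(vdotC _ u). Qed.

Lemma vdotZr k u v : vdot u (k *: v) = k * vdot u v.
Proof. by rewrite vdotC vdotZl vdotC. Qed.

Lemma vdot_sumr (I : Type) (r : seq I) (x : I -> 'rV[R]_n) u :
  vdot u (\sum_(i <- r) x i) = \sum_(i <- r) vdot u (x i).
Proof.
elim: r => [|i r IH]; last by rewrite !big_cons vdotDr IH.
by rewrite !big_nil /vdot big1// => i _; rewrite mxE mulr0.
Qed.

Lemma vdot_delta u i : vdot u (delta_mx 0 i) = u 0 i.
Proof.
rewrite /vdot (bigD1 i)//= mxE !eqxx mulr1 big1 ?addr0// => j /negPf ji.
by rewrite mxE ji andbF mulr0.
Qed.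

End Vdot.

Section Exterior.
Context (R : realType) (n : nat).
Implicit Types (X Y Z : multivector R n) (A B C : {set 'I_n}).
Implicit Types (u v r s : 'rV[R]_n) (t : 'End('rV[R]_n)) (k : R).

Lemma coefP X Y : (forall A, coef X A = coef Y A) -> X = Y.
Proof. by move=> XY; apply/ffunP. Qed.

Lemma coefD X Y A : coef (X + Y) A = coef X A + coef Y A.
Proof. by rewrite /coef ffunE. Qed.

Lemma coefZ k X A : coef (k *: X) A = k * coef X A.
Proof. by rewrite /coef ffunE. Qed.

Lemma coef_sum (I : Type) (l : seq I) (P : pred I)
    (F : I -> multivector R n) A :
  coef (\sum_(i <- l | P i) F i) A = \sum_(i <- l | P i) coef (F i) A.
Proof. by rewrite /coef sum_ffunE. Qed.

Lemma coef_blade A B : coef (blade R A) B = (B == A)%:R.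
Proof. by rewrite /coef ffunE. Qed.

Lemma coef_of_vec v A : coef (of_vec v) A = \sum_(i < n) v 0 i * (A == [set i]%SET)%:R.
Proof. by rewrite coef_sum; apply: eq_bigr => i _;
  rewrite coefZ coef_blade. Qed.

Lemma coef_of_vec1 v i : coef (of_vec v) [set i]%SET = v 0 i.
Proof.
rewrite coef_of_vec (bigD1 i)//= eqxx mulr1 big1 ?addr0// => j /negPf ji.
by rewrite (inj_eq set1_inj) eq_sym ji mulr0.
Qed.

Lemma of_vec_grade1 X : of_grade 1 X -> X = of_vec (\row_i coef X [set i]%SET).
Proof.
move=> X1; apply: coefP => A; have [/cards1P[i ->]|A1] := boolP (#|A| == 1)%N.
  by rewrite coef_of_vec1 mxE.
rewrite X1// coef_of_vec big1// => i _.
have [Ai|_] := eqVneq A [set i]%SET; last by rewrite mulr0.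
by rewrite Ai cards1 in A1.
Qed.

Lemma of_vec_linear : linear (@of_vec R n).
Proof.
move=> k u v; apply: coefP => A; rewrite coefD coefZ !coef_of_vec mulr_sumr.
by rewrite -big_split; apply: eq_bigr => i _; rewrite !mxE/= mulrDl mulrA.
Qed.

Lemma of_vec_delta i : of_vec (delta_mx 0 i : 'rV[R]_n) = blade R [set i]%SET.
Proof.
rewrite /of_vec (bigD1 i)//= mxE !eqxx scale1r big1 ?addr0// => j /negPf ji.
by rewrite mxE ji andbF scale0r.
Qed.

Lemma of_vec_bladeE v : of_vec v = \sum_(i < n) v 0 i *: blade R [set i]%SET.
Proof. by []. Qed.

Lemma of_vecE v : of_vec v = \sum_(i < n) v 0 i *: of_vec (delta_mx 0 i : 'rV[R]_n).
Proof. by apply: eq_bigr => i _; rewrite of_vec_delta. Qed.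

Lemma mvdotC X Y : mvdot X Y = mvdot Y X.
Proof. by apply: eq_bigr => A _; rewrite mulrC. Qed.

Lemma mvdotDr X Y Z : mvdot X (Y + Z) = mvdot X Y + mvdot X Z.
Proof. by rewrite -big_split; apply: eq_bigr => A _; rewrite coefD mulrDr. Qed.

Lemma mvdotZr k X Y : mvdot X (k *: Y) = k * mvdot X Y.
Proof. by rewrite mulr_sumr; apply: eq_bigr => A _; rewrite coefZ mulrCA. Qed.

Lemma mvdotZl k X Y : mvdot (k *: X) Y = k * mvdot X Y.
Proof. by rewrite mvdotC mvdotZr mvdotC. Qed.

Lemma mvdot_sumr (I : Type) (l : seq I) (P : pred I)
    (F : I -> multivector R n) X :
  mvdot X (\sum_(i <- l | P i) F i) = \sum_(i <- l | P i) mvdot X (F i).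
Proof.
under eq_bigr do rewrite /mvdot; rewrite exchange_big; apply: eq_bigr => A _.
by rewrite coef_sum mulr_sumr.
Qed.

Lemma mvdot_suml (I : Type) (l : seq I) (P : pred I)
    (F : I -> multivector R n) X :
  mvdot (\sum_(i <- l | P i) F i) X = \sum_(i <- l | P i) mvdot (F i) X.
Proof. by rewrite mvdotC mvdot_sumr; apply: eq_bigr => i _; rewrite mvdotC. Qed.

Lemma mvdot_blade X A : mvdot X (blade R A) = coef X A.
Proof.
rewrite /mvdot (bigD1 A)//= coef_blade eqxx mulr1 big1 ?addr0// => B /negPf BA.
by rewrite coef_blade BA mulr0.
Qed.

Lemma mvdot_of_vec u v : mvdot (of_vec u) (of_vec v) = vdot u v.
Proof.
rewrite (of_vec_bladeE v) mvdot_sumr.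
by apply: eq_bigr => i _; rewrite mvdotZr mvdot_blade coef_of_vec1 mulrC.
Qed.

Lemma wedge_linear X : linear (wedge X).
Proof.
move=> k Y Z; rewrite /wedge scaler_sumr -big_split; apply: eq_bigr => A _.
rewrite scaler_sumr -big_split; apply: eq_bigr => B _ /=.
by rewrite coefD coefZ scalerA -scalerDl; congr (_ *: _); ring.
Qed.

Lemma wedge_linearl Y : linear (fun X => wedge X Y).
Proof.
move=> k X Z; rewrite /wedge scaler_sumr -big_split; apply: eq_bigr => A _.
rewrite scaler_sumr -big_split; apply: eq_bigr => B _ /=.
by rewrite coefD coefZ scalerA -scalerDl; congr (_ *: _); ring.
Qed.

Lemma wedge_sumZl (I : Type) (l : seq I) (a : I -> R)
    (x : I -> multivector R n) Y :
  wedge (\sum_(i <- l) a i *: x i) Y = \sum_(i <- l) a i *: wedge (x i) Y.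
Proof. exact: (linear_sumZ (wedge_linearl Y)). Qed.

Lemma extended_end_linear t : linear (extended_end t).
Proof.
move=> k X Y; rewrite /extended_end scaler_sumr -big_split;
  apply: eq_bigr => A _.
by rewrite coefD coefZ scalerDl scalerA.
Qed.

(** Only the blade of A minus i contributes to the component of
    b_i /\ Y on b_A, and moving b_i past the smaller indices gives the sign
    that [lcontr] carries: this is why wedge and contraction are adjoint. *)
Lemma coef_wedge_vec u Y A : coef (wedge (of_vec u) Y) A =
  \sum_(i in A) (-1) ^+ #|[set j in A | (j < i)%N]%SET| * u 0 i * coef Y (A :\ i)%SET.
Proof.
rewrite (of_vec_bladeE u) wedge_sumZl.
rewrite coef_sum [RHS]big_mkcond /=; apply: eq_bigr => i _; rewrite coefZ.
rewrite /wedge coef_sum (bigD1 [set i]%SET)//= [X in _ + X]big1 ?addr0;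
  last first.
  move=> B /negPf Bi; rewrite coef_sum big1// => C _.
  by rewrite coefZ coef_blade Bi mulr0 mul0r mul0r.
rewrite coef_sum coef_blade eqxx.
have [iA|iA] := ifPn; last first.
  rewrite big1 ?mulr0// => B _; rewrite coefZ coef_blade.
  have [AB|_] := eqVneq A ([set i] :|: B)%SET; last by rewrite mulr0.
  by rewrite AB !inE eqxx in iA.
rewrite (bigD1 (A :\ i)%SET)/=; last by rewrite disjoints1 !inE eqxx.
rewrite [X in _ + X]big1 ?addr0; last first.
  move=> B /andP[]; rewrite disjoints1 => iB BA; rewrite coefZ coef_blade.
  case: eqP => [AB|_]; last by rewrite mulr0.
  by move: BA; rewrite AB finset.setU1K// eqxx.
rewrite coefZ coef_blade finset.setD1K// eqxx !mulr1.
have -> : inversions [set i]%SET (A :\ i)%SET = #|[set j in A | (j < i)%N]%SET|.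
  rewrite /inversions -(card_imset _ (can_inj (fun j : 'I_n => erefl : (i, j).2 = j))).
  apply: eq_card => -[p q]; rewrite !inE /=; apply/idP/imsetP => [|[j]].
    move=> /and3P[/eqP -> /andP[qi qA] lt]; exists q => //.
    by rewrite inE qA.
  by rewrite inE => /andP[jA ji] [-> ->];
    rewrite eqxx jA ji -val_eqE/= neq_ltn ji.
ring.
Qed.

Lemma mvdot_lcontr u X Y : mvdot (lcontr u X) Y = mvdot X (wedge (of_vec u) Y).
Proof.
rewrite mvdotC /lcontr.
rewrite mvdot_sumr; apply: eq_bigr => A _.
rewrite mvdot_sumr coef_wedge_vec mulr_sumr; apply: eq_bigr => i _.
rewrite mvdotZr mvdot_blade; ring.
Qed.

Lemma lcontr_grade1 u X : of_grade 2 X -> of_grade 1 (lcontr u X).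
Proof.
move=> X2 C C1; rewrite /lcontr coef_sum big1// => A _;
  rewrite coef_sum big1// => i iA.
rewrite coefZ coef_blade; case: eqP => [CA|_]; last by rewrite mulr0.
rewrite X2 ?mulr0 ?mul0r//; move: C1; rewrite CA.
by apply: contra => /eqP; rewrite (cardsD1 i A) iA add1n => -[->].
Qed.

Local Notation basis2 i j := (wedge (of_vec (delta_mx 0 i : 'rV[R]_n))
                                    (of_vec (delta_mx 0 j : 'rV[R]_n))).

Lemma wedge_of_vec u v : wedge (of_vec u) (of_vec v) =
  \sum_(i < n) \sum_(j < n) (u 0 i * v 0 j) *: basis2 i j.
Proof.
rewrite [in LHS](of_vecE u) wedge_sumZl; apply: eq_bigr => i _.
rewrite [in LHS](of_vecE v) (linear_sumZ (wedge_linear _)) scaler_sumr.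
by apply: eq_bigr => j _; rewrite scalerA.
Qed.

Lemma wedge_basis i j : basis2 i j =
  if i == j then 0 else (-1) ^+ (j < i)%N *: blade R [set i; j]%SET.
Proof.
apply: coefP => A; rewrite coef_wedge_vec big_mkcond (bigD1 i)//= big1 ?addr0;
  last first.
  by move=> k /negPf ki; rewrite mxE ki andbF mulr0 mul0r if_same.
rewrite mxE !eqxx mulr1 of_vec_delta coef_blade.
have [<-|ij] := eqVneq i j.
  rewrite /coef ffunE; case: ifP => // iA; case: eqP => [Ai|_];
    last by rewrite mulr0.
  by have := finset.setD11 i A; rewrite Ai inE eqxx.
rewrite coefZ coef_blade.
have [->|Aij] := eqVneq A [set i; j]%SET.
  rewrite !inE eqxx/= finset.setU1K ?inE// eqxx; congr (_ ^+ _ * _).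
  have -> : [set k in [set i; j] | (k < i)%N]%SET =
      if (j < i)%N then [set j]%SET else finset.set0.
    apply/setP => k; rewrite !inE; have [->|ki] /= := eqVneq k i.
      by rewrite ltnn; case: ifP => _; rewrite inE// (negPf ij).
    by have [->|kj] /= := eqVneq k j; case: ifP => _;
      rewrite inE ?eqxx// (negPf kj).
  by case: ifP => _; rewrite ?cards1 ?cards0.
case: ifP => iA; rewrite mulr0//; case: eqP => [Ai|_]; last by rewrite mulr0.
by move: Aij; rewrite -(finset.setD1K iA) Ai eqxx.
Qed.

Lemma wedge_basis_anti i j : basis2 i j = - basis2 j i.
Proof.
rewrite !wedge_basis (eq_sym j i); have [_|ij] := eqVneq i j;
  first by rewrite oppr0.
rewrite finset.setUC -scaleNr; congr (_ *: _).
case: ltngtP ij => [_ _|_ _|/val_inj ->]; rewrite ?expr0 ?expr1 ?opprK//.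
by rewrite eqxx.
Qed.

Lemma wedge_vec_anti u v : wedge (of_vec u) (of_vec v) = - wedge (of_vec v) (of_vec u).
Proof.
rewrite !wedge_of_vec -sumrN exchange_big; apply: eq_bigr => i _ /=.
rewrite -sumrN; apply: eq_bigr => j _; rewrite wedge_basis_anti scalerN mulrC.
by [].
Qed.

Lemma wedge_vec_grade2 u v : of_grade 2 (wedge (of_vec u) (of_vec v)).
Proof.
move=> A A2; rewrite wedge_of_vec coef_sum big1// => i _;
  rewrite coef_sum big1// => j _.
rewrite coefZ wedge_basis; have [_|ij] := eqVneq i j;
  first by rewrite /coef ffunE mulr0.
rewrite coefZ coef_blade; have [Aij|_] := eqVneq A [set i; j]%SET;
  last by rewrite !mulr0.
by rewrite Aij cards2 ij in A2.
Qed.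

Lemma grade2_eq0 X : of_grade 2 X ->
  (forall i j, mvdot X (basis2 i j) = 0) -> X = 0.
Proof.
move=> X2 X0; apply: coefP => A; rewrite [RHS]ffunE.
have [/cards2P[i [j [ij ->]]]|A2] := boolP (#|A| == 2)%N; last exact: X2.
have := X0 i j; rewrite wedge_basis (negPf ij) mvdotZr mvdot_blade => /eqP.
by rewrite mulf_eq0 signr_eq0 => /eqP.
Qed.

Lemma mvdot_basis2 i j p q : mvdot (basis2 i j) (basis2 p q) =
  (i == p)%:R * (j == q)%:R - (i == q)%:R * (j == p)%:R.
Proof.
rewrite !wedge_basis; have [<-|ij] := eqVneq i j.
  rewrite mulrC subrr /mvdot big1// => A _.
  by rewrite /coef ffunE mul0r.
have [<-|pq] := eqVneq p q.
  rewrite subrr /mvdot big1// => A _.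
  by rewrite {2}/coef ffunE mulr0.
rewrite mvdotZl mvdotZr mvdot_blade coef_blade.
have [eip|ip] := eqVneq i p; have [ejq|jq] := eqVneq j q.
- by subst p q; rewrite eqxx (negPf ij) mul0r subr0 !mulr1 -expr2 sqrr_sign.
- subst p; rewrite (negPf pq) mulr0 mul0r subrr.
  case: eqP => [/setP/(_ j)|_]; last by rewrite !mulr0.
  by rewrite !inE eqxx orbT eq_sym (negPf ij) (negPf jq).
- subst q; rewrite (negPf ij) !mul0r subrr.
  case: eqP => [/setP/(_ i)|_]; last by rewrite !mulr0.
  by rewrite !inE eqxx (negPf ip) (negPf ij).
- rewrite mulr0 sub0r; have [eiq|iq] := eqVneq i q; have [ejp|jp] := eqVneq j p.
  + subst p q; rewrite finset.setUC eqxx !mulr1.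
    case: ltngtP ij => [_ _|_ _|/val_inj ->]; last by rewrite eqxx.
      by rewrite expr0 expr1 mulr1 mulr1n.
    by rewrite expr0 expr1 mul1r mulr1n.
  + subst q; case: eqP => [/setP/(_ j)|_]; last by rewrite !mulr0 oppr0.
    by rewrite !inE eqxx orbT (negPf jp) eq_sym (negPf ij).
  + case: eqP => [/setP/(_ i)|_]; last by rewrite !mulr0 mul0r oppr0.
    by rewrite !inE eqxx (negPf ip) (negPf iq).
  + case: eqP => [/setP/(_ i)|_]; last by rewrite !mulr0 oppr0.
    by rewrite !inE eqxx (negPf ip) (negPf iq).
Qed.

Lemma mvdot_wedge_basis u v p q :
  mvdot (wedge (of_vec u) (of_vec v)) (basis2 p q) =
  u 0 p * v 0 q - u 0 q * v 0 p.
Proof.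
have delta (w : 'rV[R]_n) l : w 0 l = \sum_(i < n) w 0 i * (i == l)%:R.
  by rewrite -vdot_delta; apply: eq_bigr => i _; rewrite mxE eqxx.
rewrite wedge_of_vec mvdot_suml.
under eq_bigr do rewrite mvdot_suml.
rewrite (delta u p) (delta u q) (delta v p) (delta v q) !big_distrlr -sumrB.
apply: eq_bigr => i _; rewrite -sumrB; apply: eq_bigr => j _ /=.
rewrite mvdotZl mvdot_basis2; ring.
Qed.

Lemma mvdot_wedge u v r s :
  mvdot (wedge (of_vec u) (of_vec v)) (wedge (of_vec r) (of_vec s)) =
  vdot u r * vdot v s - vdot u s * vdot v r.
Proof.
rewrite (wedge_of_vec r) mvdot_sumr (mulrC (vdot u s)) !big_distrlr -sumrB.
apply: eq_bigr => p _; rewrite mvdot_sumr -sumrB; apply: eq_bigr => q _ /=.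
rewrite mvdotZr mvdot_wedge_basis; ring.
Qed.

Lemma filter_index_enum (s : seq 'I_n) A :
  sorted (relpre val ltn) s -> s =i A -> [seq i <- index_enum 'I_n | i \in A] = s.
Proof.
move=> ss sA; apply: (@irr_sorted_eq _ (relpre val ltn)) => //.
- by move=> x y z; exact: ltn_trans.
- by move=> i; exact: ltnn.
- apply: sorted_filter => [x y z|]; first exact: ltn_trans.
  rewrite /index_enum -enumT -(sorted_map (f := val) (e' := ltn)).
  by rewrite val_enum_ord iota_ltn_sorted.
- by move=> i; rewrite mem_filter mem_index_enum andbT -sA.
Qed.

Lemma wedge_vec1 u : wedge (of_vec u) (blade R finset.set0) = of_vec u.
Proof.
apply: coefP => A; rewrite coef_wedge_vec coef_of_vec big_mkcond.
apply: eq_bigr => i _ /=; rewrite coef_blade.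
have [->|Ai] := eqVneq A [set i]%SET.
  rewrite set11 finset.setDv eqxx !mulr1.
  have -> : [set j in [set i] | (j < i)%N]%SET = finset.set0.
    by apply/setP => j; rewrite !inE; case: eqP => // ->; rewrite ltnn.
  by rewrite cards0 expr0 mul1r.
rewrite mulr0; case: ifP => // iA; case: eqP => [A0|_]; last by rewrite mulr0.
by move: Ai; rewrite -(finset.setD1K iA) A0 finset.setU0 eqxx.
Qed.

Lemma extended_end_blade t A : extended_end t (blade R A) =
  \big[@wedge R n/blade R finset.set0]_(i in A) of_vec (t (delta_mx 0 i)).
Proof.
rewrite /extended_end (bigD1 A)//= coef_blade eqxx scale1r big1 ?addr0// => B /negPf BA.
by rewrite coef_blade BA scale0r.
Qed.

Lemma extended_end_vec t u : extended_end t (of_vec u) = of_vec (t u).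
Proof.
rewrite {2}(row_sum_delta u) linear_sum (of_vec_bladeE u).
rewrite (linear_sumZ (extended_end_linear t)).
under [in RHS]eq_bigr do rewrite linearZ.
rewrite (linear_sumZ of_vec_linear); apply: eq_bigr => i _; congr (_ *: _).
rewrite extended_end_blade -big_filter (@filter_index_enum [:: i])//.
  by rewrite big_cons big_nil wedge_vec1.
by move=> j; rewrite !inE.
Qed.

(** The wedge defining [extended_end] follows the increasing enumeration; the
    other orders are reached by antisymmetry. *)
Lemma extended_end_basis2 t i j : extended_end t (basis2 i j) =
  wedge (of_vec (t (delta_mx 0 i))) (of_vec (t (delta_mx 0 j))).
Proof.
have ext_lt (p q : 'I_n) : (p < q)%N -> extended_end t (basis2 p q) =
    wedge (of_vec (t (delta_mx 0 p))) (of_vec (t (delta_mx 0 q))).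
  move=> pq; rewrite wedge_basis -val_eqE (ltn_eqF pq) ltnNge (ltnW pq) /= scale1r.
  rewrite extended_end_blade -big_filter (@filter_index_enum [:: p; q]).
  - by rewrite !big_cons big_nil wedge_vec1.
  - by rewrite /= pq.
  - by move=> l; rewrite !inE.
have extZ k X : extended_end t (k *: X) = k *: extended_end t X.
  have := extended_end_linear t k X 0.
  by rewrite addr0 => ->; rewrite [extended_end t 0]big1 ?addr0// => A _;
    rewrite /coef ffunE scale0r.
case: (ltngtP i j) => [/ext_lt//|ji|/val_inj <-].
  rewrite wedge_basis_anti -scaleN1r extZ ext_lt// scaleN1r.
  by rewrite [RHS]wedge_vec_anti.
have ww X : X = - X -> X = 0.
  move=> XX; apply: coefP => A; move/(congr1 (fun Y => coef Y A)): XX.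
  rewrite /coef !ffunE; lra.
rewrite (ww _ (wedge_vec_anti (t (delta_mx 0 i)) _)) (ww _ (wedge_basis_anti i i)).
by have := extZ 0 0; rewrite !scale0r.
Qed.

Lemma extended_end_wedge t u v : extended_end t (wedge (of_vec u) (of_vec v)) =
  wedge (of_vec (t u)) (of_vec (t v)).
Proof.
rewrite wedge_of_vec.
rewrite -!extended_end_vec (of_vecE u) (of_vecE v).
rewrite !(linear_sumZ (extended_end_linear t)) wedge_sumZl.
have ext_sum := linear_sumZ (extended_end_linear t).
under eq_bigr do under eq_bigr do rewrite -scalerA.
under eq_bigr do rewrite -scaler_sumr.
rewrite ext_sum; apply: eq_bigr => i _; congr (_ *: _).
rewrite ext_sum (linear_sumZ (wedge_linear _)); apply: eq_bigr => j _.
by rewrite extended_end_basis2 !extended_end_vec.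
Qed.
End Exterior.

(** * Metrics at a point *)

Lemma linfun_linearE (K : fieldType) (V W : vectType K) (f : V -> W) :
  linear f -> forall v, linfun f v = f v.
Proof.
move=> lf v; pose lm := GRing.isLinear.Build _ _ _ _ _ lf.
pose F : {linear V -> W} := HB.pack f lm.
exact: (lfunE F v).
Qed.

Section Metric.
Context (R : realType) (n : nat) (t : 'End('rV[R]_n)).
Implicit Types (u v w : 'rV[R]_n) (X : multivector R n).

Lemma vdot_adjoint u v : vdot (adjoint_end t u) v = vdot u (t v).
Proof.
have lin : linear (fun w : 'rV[R]_n => \row_i vdot w (t (delta_mx 0 i))).
  by move=> k w z; apply/rowP => i; rewrite !mxE vdotDl vdotZl.
rewrite /adjoint_end (linfun_linearE lin).
rewrite {2}(row_sum_delta v) linear_sum vdot_sumr; apply: eq_bigr => i _.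
by rewrite linearZ vdotZr mxE mulrC.
Qed.

Hypotheses (t_sym : adjoint_end t = t) (t_det : \det (lin1_mx t) != 0).

Lemma vdot_metric u v : vdot (t u) v = vdot u (t v).
Proof. by rewrite -{1}t_sym vdot_adjoint. Qed.

Lemma metric_invE v : (t^-1)%VF v = v *m invmx (lin1_mx t).
Proof.
have tU : lin1_mx t \in unitmx by rewrite unitmxE unitfE.
have tE w : t w = w *m lin1_mx t by rewrite mul_rV_lin1.
have ker0 : lker t == 0%VS.
  apply/lker0P => u w; rewrite !tE => /(congr1 (mulmx^~ (invmx (lin1_mx t)))).
  by rewrite !mulmxK.
by rewrite -{1}(mulmxKV tU v) -tE (lker0_lfunK ker0).
Qed.

Lemma metric_invK v : t ((t^-1)%VF v) = v.
Proof.
rewrite metric_invE -mul_rV_lin1 mulmxKV//.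
by rewrite unitmxE unitfE.
Qed.

Lemma vdot_metric_inv u v : vdot ((t^-1)%VF u) (t v) = vdot u v.
Proof. by rewrite -vdot_metric metric_invK. Qed.

(** A contracted bivector is a vector, so the self-adjointness of the metric
    moves it to the other factor, where contraction becomes wedge. *)
Lemma gdot_gcomm X v w c : of_grade 2 X ->
  gdot t (of_vec v + gcomm t X w) (of_vec c) =
  vdot (t v) c - mvdot X (wedge (of_vec (t w)) (of_vec (t c))).
Proof.
move=> X2; rewrite /gdot /gcomm.
have Y1 := of_vec_grade1 (lcontr_grade1 (t w) X2).
rewrite -mvdot_lcontr [in LHS]Y1 [in RHS]Y1.
set y := \row_i _.
have -> : of_vec v - of_vec y = of_vec (v - y).
  by rewrite addrC -scaleN1r -of_vec_linear scaleN1r addrC.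
rewrite extended_end_vec !mvdot_of_vec linearB vdotBl; congr (_ - _).
exact: vdot_metric.
Qed.

(** A bivector is determined by its products with the bivectors
    [t b /\ t c], the metric being invertible. *)
Lemma bivector_eq X Y : of_grade 2 X -> of_grade 2 Y ->
  (forall b c, mvdot X (wedge (of_vec (t b)) (of_vec (t c))) =
               mvdot Y (wedge (of_vec (t b)) (of_vec (t c)))) -> X = Y.
Proof.
move=> X2 Y2 XY; apply/eqP; rewrite -subr_eq0; apply/eqP; apply: grade2_eq0.
  move=> A A2; rewrite coefD -scaleN1r coefZ X2// Y2// mulr0 addr0//.
move=> i j.
have := XY ((t^-1)%VF (delta_mx 0 i)) ((t^-1)%VF (delta_mx 0 j)).
rewrite !metric_invK => e.
by rewrite mvdotC mvdotDr -scaleN1r mvdotZr !(mvdotC (wedge _ _)) e mulN1r subrr.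
Qed.

End Metric.

Section Reciprocal.
Context (R : realType) (n : nat).

Lemma reciprocal_expansion (e e' : n.-tuple 'rV[R]_n) (v : 'rV[R]_n) :
  reciprocal_bases e e' -> v = \sum_(i < n) vdot (tnth e' i) v *: tnth e i.
Proof.
move=> [be _ ee'].
rewrite {1}(coord_basis be (memvf v)); apply: eq_bigr => i _.
rewrite -tnth_nth; congr (_ *: _).
rewrite {2}(coord_basis be (memvf v)) vdot_sumr (bigD1 i)//= big1.
  by rewrite -tnth_nth vdotZr vdotC ee' eqxx mulr1 addr0.
by move=> j /negPf ji; rewrite -tnth_nth vdotZr vdotC ee' ji mulr0.
Qed.

Lemma orthonormal_reciprocal (e : n.-tuple 'rV[R]_n) :
  (forall i j, vdot (tnth e i) (tnth e j) = (i == j)%:R) -> reciprocal_bases e e.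
Proof.
move=> ee; have be : basis_of fullv e.
  rewrite basisEfree size_tuple subvf dimvf /dim /= mul1n leqnn andbT.
  apply/freeP => k k0 i; have := congr1 (vdot (tnth e i)) k0.
  rewrite vdot_sumr (bigD1 i)//= big1 ?addr0; last first.
    by move=> j /negPf ji; rewrite -tnth_nth vdotZr ee eq_sym ji mulr0.
  rewrite -tnth_nth vdotZr ee eqxx mulr1 => ->.
  by rewrite /vdot big1// => j _; rewrite mxE mulr0.
by split.
Qed.

Definition std_basis : n.-tuple 'rV[R]_n := [tuple delta_mx 0 i | i < n].

Lemma std_basis_reciprocal : reciprocal_bases std_basis std_basis.
Proof.
apply: orthonormal_reciprocal => i j.
by rewrite !tnth_mktuple vdot_delta mxE eqxx eq_sym.
Qed.

(** The pairing [t^-1(e^i) . t(b)] is the i-th coordinate of b in the basis e, so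
    that the determinants of [mvdot_wedge] add up to S(b, c) - S(c, b). *)
Lemma mvdot_skew_bivector (t : 'End('rV[R]_n)) (e e' : n.-tuple 'rV[R]_n)
    (S : 'rV[R]_n -> 'rV[R]_n -> R) (b c : 'rV[R]_n) :
  adjoint_end t = t -> \det (lin1_mx t) != 0 -> reciprocal_bases e e' ->
  (forall v, linear (S v : _ -> R^o)) -> (forall u v, S u v = - S v u) ->
  mvdot (\sum_(i < n) \sum_(j < n) S (tnth e i) (tnth e j) *:
           wedge (of_vec ((t^-1)%VF (tnth e' i))) (of_vec ((t^-1)%VF (tnth e' j))))
        (wedge (of_vec (t b)) (of_vec (t c))) = S b c *+ 2.
Proof.
move=> ts td ee lS aS.
have Sexp (p q : 'I_n -> R) :
    S (\sum_(i < n) p i *: tnth e i) (\sum_(i < n) q i *: tnth e i) =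
    \sum_(i < n) \sum_(j < n) p i * q j * S (tnth e i) (tnth e j).
  rewrite (linear_sumZ (lS _)) exchange_big; apply: eq_bigr => j _ /=.
  rewrite aS (linear_sumZ (lS _)).
  transitivity (q j * - \sum_(i < n) p i * S (tnth e j) (tnth e i));
    first by [].
  rewrite -sumrN mulr_sumr; apply: eq_bigr => i _.
  rewrite (aS (tnth e i)); ring.
rewrite mvdot_suml.
have -> : S b c *+ 2 = S b c - S c b by rewrite (aS c b) opprK.
have Sbc u v : S u v = \sum_(i < n) \sum_(j < n)
    vdot (tnth e' i) u * vdot (tnth e' j) v * S (tnth e i) (tnth e j).
  by rewrite {1}(reciprocal_expansion u ee) {1}(reciprocal_expansion v ee) Sexp.
rewrite (Sbc b c) (Sbc c b) -sumrB; apply: eq_bigr => i _;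
  rewrite -sumrB mvdot_suml.
apply: eq_bigr => j _; rewrite mvdotZl mvdot_wedge !vdot_metric_inv//; ring.
Qed.

End Reciprocal.

(** * The Christoffel operator *)

Section Christoffel.

Context (R : realType) (n : nat) (M : smoothManifold R n) (phi : chart R n M).
Context (U : set M) (g : M -> 'End('rV[R]_n)).
Hypotheses (aphi : atlas phi) (oU : open U) (Uphi : (U `<=` cdom phi)%classic).
Hypothesis g_metric : metric_field U g.
Implicit Types (a b c : M -> 'rV[R]_n) (x : M) (u v : 'rV[R]_n).

Let e_ i : 'rV[R]_n := delta_mx 0 i.

Let g_smooth i j : smooth_scalar U (fun x => g x (e_ i) 0 j).
Proof. by case: g_metric => + _; apply. Qed.

Let g_sym x : U x -> adjoint_end (g x) = g x.
Proof. by case: g_metric => _ /[apply] -[]. Qed.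

Let g_det x : U x -> \det (lin1_mx (g x)) != 0.
Proof. by case: g_metric => _ /[apply] -[]. Qed.

Lemma smooth_vector_cst u : smooth_vector U (fun=> u).
Proof. by move=> j; exact: smooth_scalar_cst. Qed.

Lemma metric_coord x u j : g x u 0 j = \sum_(i < n) u 0 i * g x (e_ i) 0 j.
Proof.
rewrite {1}(row_sum_delta u) linear_sum summxE; apply: eq_bigr => i _.
by rewrite linearZ mxE.
Qed.

Lemma smooth_metric b : smooth_vector U b -> smooth_vector U (fun y => g y (b y)).
Proof.
move=> sb j; apply: (@eq_smooth_scalar _ _ _ _
  (fun x => \sum_(i < n) b x 0 i * g x (e_ i) 0 j)) => //.
  by move=> x _; rewrite metric_coord.
by apply: smooth_scalar_sum => // i; exact: smooth_scalarM.
Qed.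

(** The product rule makes the derivatives of b cancel: only its value at x
    matters. *)
Lemma dextensorE v b x : smooth_vector U b -> U x ->
  dextensor phi v g b x =
  \row_j \sum_(i < n) b x 0 i * dscalar phi v (fun y => g y (e_ i) 0 j) x.
Proof.
move=> sb Ux; apply/rowP => j; rewrite !mxE metric_coord.
rewrite (eq_dscalar oU Uphi v (g := fun y => \sum_(i < n) b y 0 i * g y (e_ i) 0 j))//;
  last by move=> y _; exact: metric_coord.
rewrite (dscalar_sum aphi oU Uphi)//; last by move=> i; exact: smooth_scalarM.
rewrite -sumrB; apply: eq_bigr => i _.
rewrite (dscalarM aphi Uphi)// !mxE; ring.
Qed.

Lemma dextensor_cst v b x : smooth_vector U b -> U x ->
  dextensor phi v g b x = dextensor phi v g (fun=> b x) x.
Proof. by move=> sb Ux; rewrite !dextensorE//; exact: smooth_vector_cst. Qed.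

Lemma dextensor_linearl u x : U x ->
  linear (fun v => dextensor phi v g (fun=> u) x).
Proof.
move=> Ux k v w; apply/rowP => j; rewrite !dextensorE//;
  try exact: smooth_vector_cst.
rewrite !mxE mulr_sumr -big_split; apply: eq_bigr => i _ /=.
rewrite [X in _ * X = _](_ : _ = k * dscalar phi v (fun y => g y (e_ i) 0 j) x +
  dscalar phi w (fun y => g y (e_ i) 0 j) x); first by ring.
rewrite mulr_sumr -big_split; apply: eq_bigr => l _; rewrite !mxE /=; ring.
Qed.

Lemma dextensor_linearr v x : U x ->
  linear (fun u => dextensor phi v g (fun=> u) x).
Proof.
move=> Ux k u w; apply/rowP => j; rewrite !dextensorE//;
  try exact: smooth_vector_cst.
rewrite !mxE mulr_sumr -big_split; apply: eq_bigr => i _ /=.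
rewrite !mxE; ring.
Qed.

(** Self-adjointness of g on the open set U passes to its derivatives. *)
Lemma dextensor_sym v u w x : U x ->
  vdot (dextensor phi v g (fun=> u) x) w = vdot (dextensor phi v g (fun=> w) x) u.
Proof.
move=> Ux; rewrite !dextensorE//; try exact: smooth_vector_cst.
rewrite /vdot; under eq_bigr do rewrite mxE mulr_suml.
under [RHS]eq_bigr do rewrite mxE mulr_suml.
rewrite exchange_big; apply: eq_bigr => i _; apply: eq_bigr => j _ /=.
have -> : dscalar phi v (fun y => g y (e_ i) 0 j) x =
          dscalar phi v (fun y => g y (e_ j) 0 i) x.
  apply: (eq_dscalar oU Uphi) => // y Uy.
  rewrite -(vdot_delta _ j) -(vdot_delta _ i) (vdot_metric (g_sym Uy)).
  by rewrite vdotC.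
ring.
Qed.

Lemma gdot_vecE b c x : gdot_vec g b c x = vdot (g x (b x)) (c x).
Proof. by rewrite /gdot_vec /gdot extended_end_vec mvdot_of_vec. Qed.

Lemma dscalar_gdot v b c x : smooth_vector U b -> smooth_vector U c -> U x ->
  dscalar phi v (gdot_vec g b c) x =
  vdot (dextensor phi v g b x) (c x) + vdot (g x (dvector phi v b x)) (c x)
  + vdot (g x (b x)) (dvector phi v c x).
Proof.
move=> sb sc Ux.
have -> : gdot_vec g b c = fun y => vdot (g y (b y)) (c y).
  by apply/funext => y; exact: gdot_vecE.
rewrite (dscalar_vdot aphi oU Uphi _ (smooth_metric sb))//.
by rewrite -vdotDl subrK.
Qed.

(** All derivatives of b, c and a cancel against the brackets, except for
    the derivative of b along a. *)
Lemma christoffel1E a b c x :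
  smooth_vector U a -> smooth_vector U b -> smooth_vector U c -> U x ->
  christoffel1 phi g a b c x =
  vdot (g x (dvector phi (a x) b x)) (c x)
  + 2^-1 * vdot (dextensor phi (a x) g b x) (c x)
  + 2^-1 * dg_skew phi g x (a x) (b x) (c x).
Proof.
move=> sa sb sc Ux; rewrite /christoffel1 !dscalar_gdot// !gdot_vecE /dg_skew /bracket.
rewrite (dextensor_cst (b x) sc)// (dextensor_cst (c x) sa)//.
rewrite (dextensor_sym (c x) (a x))//.
(* [dextensor] is itself a difference, which [vdotBr] must not open. *)
move: (dextensor phi (b x) g _ x) (dextensor phi (c x) g _ x) => Db Dc.
rewrite !vdotBr !(vdotC (a x)).
rewrite !(vdot_metric (g_sym Ux) (dvector _ _ _ _)) !(vdotC (dvector _ _ _ _)).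
lra.
Qed.

Lemma dg_skew_anti x v (b c : 'rV[R]_n) : dg_skew phi g x v b c = - dg_skew phi g x v c b.
Proof. by rewrite /dg_skew -opprB -scaleN1r vdotZr mulN1r. Qed.

Lemma dg_skew_linearr x v (b : 'rV[R]_n) : U x -> linear (dg_skew phi g x v b : _ -> R^o).
Proof.
move=> Ux k c d; rewrite /dg_skew dextensor_linearr// dextensor_linearl//.
(* [dextensor] is itself a difference, which [vdotBr] must not open. *)
move: (dextensor _ b _ (fun=> c) _) (dextensor _ b _ (fun=> d) _) => p q.
move: (dextensor _ c _ _ _) (dextensor _ d _ _ _) => r s.
transitivity (k * vdot v (p - r) + vdot v (q - s)); last by [].
rewrite !vdotBr !vdotDr !vdotZr; ring.
Qed.

(** The inverse metric acts on the vectors rather than, extended, on their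
    wedge: this is the form to which [mvdot_wedge] applies. *)
Definition omega0 (e e' : n.-tuple 'rV[R]_n) x v : multivector R n :=
  - 4^-1 *: \sum_(i < n) \sum_(j < n)
    dg_skew phi g x v (tnth e i) (tnth e j) *:
    wedge (of_vec ((g x)^-1%VF (tnth e' i))) (of_vec ((g x)^-1%VF (tnth e' j))).

Lemma omega0_linear e e' x : linear (omega0 e e' x).
Proof.
move=> k u v; rewrite /omega0 !scaler_sumr -big_split; apply: eq_bigr => i _.
rewrite !scaler_sumr -big_split; apply: eq_bigr => j _ /=.
by rewrite !scalerA -scalerDl /dg_skew vdotDl vdotZl; congr (_ *: _); ring.
Qed.

Lemma omega0_grade2 e e' x v : of_grade 2 (omega0 e e' x v).
Proof.
move=> A A2; rewrite coefZ coef_sum big1 ?mulr0// => i _.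
rewrite coef_sum big1// => j _.
by rewrite coefZ wedge_vec_grade2// mulr0.
Qed.

Lemma mvdot_omega0 e e' x v u w : U x -> reciprocal_bases e e' ->
  mvdot (omega0 e e' x v) (wedge (of_vec (g x u)) (of_vec (g x w))) =
  - 2^-1 * dg_skew phi g x v u w.
Proof.
move=> Ux ee; rewrite mvdotZl.
rewrite (mvdot_skew_bivector _ _ (g_sym Ux) (g_det Ux) ee).
- lra.
- by move=> b; exact: dg_skew_linearr.
- by move=> b c; exact: dg_skew_anti.
Qed.

(** Once the terms of [christoffel1E] common to both sides are removed, only
    the pairing of the bivector with [g b /\ g c] is left. *)
Lemma representation_at a b c x (X : multivector R n) :
  smooth_vector U a -> smooth_vector U b -> smooth_vector U c -> U x ->
  of_grade 2 X ->
  christoffel1 phi g a b c x =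
    gdot (g x)
      (of_vec (dvector phi (a x) b x
               + 2^-1 *: (g x)^-1%VF (dextensor phi (a x) g b x))
       + gcomm (g x) X (b x))
      (of_vec (c x)) <->
  mvdot X (wedge (of_vec (g x (b x))) (of_vec (g x (c x)))) =
  - 2^-1 * dg_skew phi g x (a x) (b x) (c x).
Proof.
move=> sa sb sc Ux X2; rewrite christoffel1E// (gdot_gcomm (g_sym Ux))//.
rewrite [g x (_ + _)]linearD linearZ /= (metric_invK (g_det Ux)) (vdotDl (g x _)) vdotZl.
by split; lra.
Qed.

(** Testing the representation on constant fields b and c is enough, since
    both sides are then known to pair equally with every bivector. *)
Lemma representation_eq_omega0 (w : M -> 'Hom('rV[R]_n, multivector R n)) e e' a x :
  extensor_field12 U w -> christoffel_representation phi U g w ->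
  smooth_vector U a -> U x -> reciprocal_bases e e' ->
  w x (a x) = omega0 e e' x (a x).
Proof.
move=> [w2 _] rep sa Ux ee.
apply: (bivector_eq (g_det Ux) (w2 x Ux (a x)) (omega0_grade2 e e' x (a x))) => b c.
rewrite mvdot_omega0//.
have sb := smooth_vector_cst b; have sc := smooth_vector_cst c.
exact/(representation_at sa sb sc Ux (w2 x Ux (a x))).1/rep.
Qed.

Lemma smooth_dextensor u v j :
  smooth_scalar U (fun x => dextensor phi v g (fun=> u) x 0 j).
Proof.
apply: (@eq_smooth_scalar _ _ _ _ (fun x => \sum_(i < n) u 0 i *
    dscalar phi v (fun y => g y (e_ i) 0 j) x)) => //.
  by move=> x Ux; rewrite dextensorE ?mxE//; exact: smooth_vector_cst.
apply: smooth_scalar_sum => // i; apply: smooth_scalarM => //.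
  exact: smooth_scalar_cst.
apply: smooth_scalar_sum => // l; apply: smooth_scalarM => //.
  exact: smooth_scalar_cst.
exact: smooth_scalar_derive.
Qed.

Lemma smooth_metric_inv u j : smooth_scalar U (fun x => (g x)^-1%VF u 0 j).
Proof.
apply: (@eq_smooth_scalar _ _ _ _ (fun x => \sum_(i < n) u 0 i *
    invmx (lin1_mx (g x)) i j)) => //.
  by move=> x Ux; rewrite (metric_invE (g_det Ux)) mxE.
apply: smooth_scalar_sum => // i; apply: smooth_scalarM => //.
  exact: smooth_scalar_cst.
apply: smooth_scalar_invmx => // p q.
by apply: eq_smooth_scalar (g_smooth p q) => // x _; rewrite mxE.
Qed.

Lemma smooth_dg_skew u (b c : 'rV[R]_n) : smooth_scalar U (fun x => dg_skew phi g x u b c).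
Proof.
apply: smooth_scalar_sum => // i; apply: smooth_scalarM => //.
  exact: smooth_scalar_cst.
apply: (@eq_smooth_scalar _ _ _ _ (fun x => dextensor phi b g (fun=> c) x 0 i +
    -1 * dextensor phi c g (fun=> b) x 0 i)) => //.
  by move=> x Ux; rewrite mulN1r [in RHS]mxE [X in _ = _ + X]mxE.
apply: smooth_scalarD => //; first exact: smooth_dextensor.
apply: smooth_scalarM => //; first exact: smooth_scalar_cst.
exact: smooth_dextensor.
Qed.

Lemma smooth_wedge_vec a b : smooth_vector U a -> smooth_vector U b ->
  smooth_multivector U (fun x => wedge (of_vec (a x)) (of_vec (b x))).
Proof.
move=> sa sb A; apply: (@eq_smooth_scalar _ _ _ _ (fun x => \sum_(i < n) \sum_(j < n)
    a x 0 i * b x 0 j * coef (wedge (of_vec (e_ i)) (of_vec (e_ j))) A)) => //.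
  move=> x _; rewrite wedge_of_vec coef_sum; apply: eq_bigr => i _.
  by rewrite coef_sum; apply: eq_bigr => j _; rewrite coefZ.
apply: smooth_scalar_sum => // i; apply: smooth_scalar_sum => // j.
by apply: smooth_scalarM => //;
  [exact: smooth_scalarM|exact: smooth_scalar_cst].
Qed.

Lemma smooth_omega0 e e' u : smooth_multivector U (fun x => omega0 e e' x u).
Proof.
move=> A; apply: (@eq_smooth_scalar _ _ _ _ (fun x => - 4^-1 * \sum_(i < n) \sum_(j < n)
    dg_skew phi g x u (tnth e i) (tnth e j) *
    coef (wedge (of_vec ((g x)^-1%VF (tnth e' i)))
                (of_vec ((g x)^-1%VF (tnth e' j)))) A)) => //.
  move=> x _; rewrite coefZ coef_sum; congr (_ * _); apply: eq_bigr => i _.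
  by rewrite coef_sum; apply: eq_bigr => j _; rewrite coefZ.
apply: smooth_scalarM => //; first exact: smooth_scalar_cst.
apply: smooth_scalar_sum => // i; apply: smooth_scalar_sum => // j.
apply: smooth_scalarM => //; first exact: smooth_dg_skew.
by apply: smooth_wedge_vec => l; exact: smooth_metric_inv.
Qed.

End Christoffel.

Theorem mainTheorem1 (R : realType) (n : nat) (M : smoothManifold R n)
    (phi : chart R n M) (U : set M) (g : M -> 'End('rV[R]_n)) :
  atlas phi -> open U -> (U `<=` cdom phi)%classic -> metric_field U g ->
  (exists w : M -> 'Hom('rV[R]_n, multivector R n),
     extensor_field12 U w /\ christoffel_representation phi U g w) /\
  (forall w : M -> 'Hom('rV[R]_n, multivector R n),
     extensor_field12 U w -> christoffel_representation phi U g w ->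
     forall (a : M -> 'rV[R]_n) (x : M), smooth_vector U a -> U x ->
     forall e e' : n.-tuple 'rV[R]_n, reciprocal_bases e e' ->
       w x (a x) = - 4^-1 *: \sum_(i < n) \sum_(j < n)
         dg_skew phi g x (a x) (tnth e i) (tnth e j) *:
         extended_end (g x)^-1%VF
           (wedge (of_vec (tnth e' i)) (of_vec (tnth e' j))) /\
       w x (a x) = - 4^-1 *: \sum_(i < n) \sum_(j < n)
         dg_skew phi g x (a x) (tnth e i) (tnth e j) *:
         wedge (of_vec ((g x)^-1%VF (tnth e' i)))
               (of_vec ((g x)^-1%VF (tnth e' j)))).
Proof.
move=> aphi oU Uphi gm; split; last first.
  move=> w ew rep a x sa Ux e e' ee.
  have wE := representation_eq_omega0 aphi oU Uphi gm ew rep sa Ux ee.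
  split; last exact: wE.
  rewrite wE /omega0; congr (_ *: _); apply: eq_bigr => i _;
    apply: eq_bigr => j _.
  by rewrite extended_end_wedge.
pose o := omega0 phi g (std_basis R n) (std_basis R n).
have oE x v : linfun (o x) v = o x v by exact/linfun_linearE/omega0_linear.
exists (fun x => linfun (o x)); split.
  split=> [x Ux v|i A]; first by rewrite oE; exact: omega0_grade2.
  have := smooth_omega0 aphi oU Uphi gm (std_basis R n) (std_basis R n) (delta_mx 0 i) A.
  by apply: eq_smooth_scalar => // x _; rewrite oE.
move=> a b c sa sb sc x Ux; rewrite oE.
have ee := std_basis_reciprocal R n.
apply: (representation_at aphi oU Uphi gm sa sb sc Ux
  (omega0_grade2 phi g (std_basis R n) (std_basis R n) x (a x))).2.
exact: (mvdot_omega0 aphi oU Uphi gm _ _ _ Ux ee).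
Qed.
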